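(* Let $E$ be a truncated normed Riesz space with norm $\|\cdot\|$. The formula $$\|x+\alpha\|_{1}=\left\|\left(|x+\alpha|-|\alpha|\right)^{+}\right\|+|\alpha|,\qquad x\in E,\ \alpha\in\mathbb{R},$$ defines the largest unitization norm on $E\oplus\mathbb{R}$; that is, $\|\cdot\|_1$ is a unitization norm on $E\oplus\mathbb{R}$, and every unitization norm $\|\cdot\|_u$ on $E\oplus\mathbb{R}$ satisfies $\|x+\alpha\|_u\leq\|x+\alpha\|_1$ for all $x\in E$ and $\alpha\in\mathbb{R}$.
   Context: All Riesz spaces are real. A truncated Riesz space is a nonzero Riesz space $E$ together with a truncation, i.e. a nonzero map $x\mapsto x^{*}$ from the positive cone $E^{+}$ into itself such that $x\wedge y^{*}\leq x^{*}\leq x$ for all $x,y\in E^{+}$. Unitization: the vector space direct sum $E\oplus\mathbb{R}$ (elements written $x+\alpha$ with $x\in E$, $\alpha\in\mathbb{R}$; $1$ denotes $0+1$; $x\in E$ is identified with $x+0$) is a Riesz space whose absolute value is given by $|x+0|=|x|$ and, for $\alpha\neq 0$, $|x+\alpha|=|x|-2|\alpha|\left(\tfrac{1}{\alpha}x^{-}\vee\tfrac{-1}{\alpha}x^{+}\right)^{*}+|\alpha|$. Equivalently, $x+\alpha\geq 0$ if and only if either $\alpha=0$ and $x\geq 0$, or $\alpha>0$ and $\left(\tfrac1\alpha x^{-}\right)^{*}=\tfrac1\alpha x^{-}$. For this structure (known from earlier work) $E$ is a Riesz subspace of $E\oplus\mathbb{R}$ and $x^{*}=1\wedge x$ for all $x\in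 E^{+}$. One has $|x+\alpha|-|\alpha|\in E$ for all $x\in E$, $\alpha\in\mathbb{R}$. A lattice norm on a Riesz space is a norm such that $|u|\leq|v|$ implies $\|u\|\leq\|v\|$. A truncated normed Riesz space is a truncated Riesz space $E$ with a lattice norm $\|\cdot\|$ for which the truncation is norm-bounded; as a standing normalization, $\sup\{\|x^{*}\|:x\in E^{+}\}=1$. A unitization norm on $E\oplus\mathbb{R}$ is a lattice norm $\|\cdot\|_u$ on $E\oplus\mathbb{R}$ extending $\|\cdot\|$ (i.e. $\|x\|_u=\|x\|$ for $x\in E$) with $\|1\|_u=1$. *)

(* Defs.v *)
From HB Require Import structures.
From mathcomp Require Import all_boot all_order all_algebra.
From mathcomp Require Import boolp classical_sets reals.

Set Implicit Arguments.
Unset Strict Implicit.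
Unset Printing Implicit Defensive.

Import Order.TTheory GRing.Theory Num.Theory.

Local Open Scope order_scope.
Local Open Scope ring_scope.

(* HB does not allow joining [GRing.Lmodule] with [Order.Lattice ring_display],
   so the lattice operations are fields of the Riesz mixin and the library's
   [Order.Lattice] structure is recovered from them just below. *)
#[short(type="porderLmodType")]
HB.structure Definition POrderedLmodule (R : realType) :=
  { E of GRing.Lmodule R E & Num.POrderedZmodule E }.

HB.mixin Record POrderedLmodule_isRiesz (R : realType) E
    of @POrderedLmodule R E := {
  riesz_meet : E -> E -> E ;
  riesz_join : E -> E -> E ;
  riesz_lexI : forall x y z, (x <= riesz_meet y z) = (x <= y) && (x <= z) ;
  riesz_leUx : forall x y z, (riesz_join x y <= z) = (x <= z) && (y <= z) ;
  riesz_leD2r : forall z x y : E, x <= y -> x + z <= y + z ;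
  riesz_scale_ge0 : forall (a : R) (x : E), 0 <= a -> 0 <= x -> 0 <= a *: x
}.

#[short(type="rieszType")]
HB.structure Definition Riesz (R : realType) :=
  { E of POrderedLmodule_isRiesz R E & @POrderedLmodule R E }.

Arguments riesz_leD2r {R s} z [x y] : rename.
Arguments riesz_scale_ge0 {R s} [a x] : rename.

HB.instance Definition _ (R : realType) (E : rieszType R) :=
  Order.POrder_MeetJoin_isLattice.Build ring_display (Riesz.sort E)
    riesz_lexI riesz_leUx.

Section RieszTheory.
Context {R : realType} {E : rieszType R}.
Implicit Types (x y z : E) (a : R).

Definition rpos x : E := x `|` 0.
Definition rneg x : E := (- x) `|` 0.
Definition rabs x : E := x `|` (- x).

Lemma riesz_leD z x y : (x + z <= y + z) = (x <= y).
Proof.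
apply/idP/idP; last exact: riesz_leD2r.
by move=> /(riesz_leD2r (- z)); rewrite !addrK.
Qed.

Lemma riesz_subr_ge0 x y : (0 <= y - x) = (x <= y).
Proof. by rewrite -[RHS](riesz_leD (- x)) subrr. Qed.

Lemma riesz_leN x y : (- y <= - x) = (x <= y).
Proof. by rewrite -[LHS]riesz_subr_ge0 opprK addrC riesz_subr_ge0. Qed.

Lemma riesz_leZ a x y : 0 < a -> (a *: x <= a *: y) = (x <= y).
Proof.
move=> a0; rewrite -[LHS]riesz_subr_ge0 -scalerBr -[RHS]riesz_subr_ge0.
apply/idP/idP; last by apply: riesz_scale_ge0; exact: ltW.
have ai : 0 <= a^-1 by rewrite invr_ge0 ltW.
move=> /(riesz_scale_ge0 ai).
by rewrite scalerA mulVf ?scale1r // gt_eqF.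
Qed.

Lemma riesz_addr_ge0 x y : 0 <= x -> 0 <= y -> 0 <= x + y.
Proof. by move=> x0 y0; apply: (le_trans y0); rewrite -{1}[y]add0r riesz_leD. Qed.

Lemma riesz_joinD x y z : (x `|` y) + z = (x + z) `|` (y + z).
Proof.
apply: le_anti; apply/andP; split; last by rewrite leUx !riesz_leD leUl leUr.
set J := (x + z) `|` (y + z); suff /(riesz_leD2r z) : x `|` y <= J - z by rewrite subrK.
by rewrite leUx -[X in X && _](riesz_leD z) -[X in _ && X](riesz_leD z) subrK leUl leUr.
Qed.

Lemma riesz_joinZ a x y : 0 < a -> a *: (x `|` y) = (a *: x) `|` (a *: y).
Proof.
move=> a0; have an : a != 0 by rewrite gt_eqF.
apply: le_anti; apply/andP; split; last by rewrite leUx !riesz_leZ // leUl leUr.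
set J := (a *: x) `|` (a *: y); suff h : x `|` y <= a^-1 *: J.
  by move: h; rewrite -(riesz_leZ _ _ a0) scalerA mulfV // scale1r.
rewrite leUx -[X in X && _](riesz_leZ _ _ a0) -[X in _ && X](riesz_leZ _ _ a0).
by rewrite scalerA mulfV // scale1r leUl leUr.
Qed.

Lemma rpos_ge0 x : 0 <= rpos x. Proof. exact: leUr. Qed.
Lemma rneg_ge0 x : 0 <= rneg x. Proof. exact: leUr. Qed.
Lemma rnegN x : rneg (- x) = rpos x. Proof. by rewrite /rneg opprK. Qed.
Lemma rposN x : rpos (- x) = rneg x. Proof. by []. Qed.
Lemma rabsN x : rabs (- x) = rabs x. Proof. by rewrite /rabs opprK joinC. Qed.

Lemma rposE x : rpos x = x + rneg x.
Proof. by rewrite addrC /rneg riesz_joinD addNr add0r joinC. Qed.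

Lemma rabsE x : rabs x = x + rneg x *+ 2.
Proof.
rewrite -scaler_nat /rneg riesz_joinZ ?ltr0n // addrC riesz_joinD scaler0 add0r.
by rewrite scalerN scaler_nat mulr2n opprD addrNK joinC.
Qed.

Lemma ler_rabs x : x <= rabs x. Proof. exact: leUl. Qed.

End RieszTheory.

Section LatticeNorm.
Context {R : realType} {E : rieszType R}.

Record lattice_norm (N : E -> R) : Prop := LatticeNorm {
  lnorm_ge0 : forall x, 0 <= N x ;
  lnorm0_eq0 : forall x, N x = 0 -> x = 0 ;
  lnormZ : forall (a : R) x, N (a *: x) = `|a| * N x ;
  ler_lnormD : forall x y, N (x + y) <= N x + N y ;
  lnorm_mono : forall x y, rabs x <= rabs y -> N x <= N y
}.

End LatticeNorm.

(* A truncation is a map on the positive cone: its values outside of it are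
   unconstrained and never used. [trunc_neq0] forces E to be nonzero. *)
Record truncation (R : realType) (E : rieszType R) := Truncation {
  trunc_fun :> E -> E ;
  trunc_ge0 : forall x : E, 0 <= x -> 0 <= trunc_fun x ;
  meet_trunc_le : forall x y : E, 0 <= x -> 0 <= y ->
    x `&` trunc_fun y <= trunc_fun x ;
  trunc_le : forall x : E, 0 <= x -> trunc_fun x <= x ;
  trunc_neq0 : exists2 x : E, 0 <= x & trunc_fun x != 0
}.

Record truncated_norm (R : realType) (E : rieszType R) (t : truncation E)
    (N : E -> R) : Prop := TruncatedNorm {
  trn_lattice_norm : lattice_norm N ;
  trn_bounded : has_ubound [set N (t x) | x in [set x : E | 0 <= x]]%classic ;
  trn_sup : sup [set N (t x) | x in [set x : E | 0 <= x]]%classic = 1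
}.

Definition unitization (R : realType) (E : rieszType R) (t : truncation E) :
  Type := (E * R^o)%type.

HB.instance Definition _ (R : realType) (E : rieszType R) (t : truncation E) :=
  GRing.Lmodule.copy (unitization t) (E * R^o)%type.

Section UnitizationOrder.
Context {R : realType} {E : rieszType R} (t : truncation E).
Implicit Types (x y c d : E) (a b k : R) (u v w : unitization t).

(* [unit_elt t x a] is x + a. *)
Definition unit_elt x a : unitization t := (x, a).

Definition unit_ge0 u : bool :=
  let: (x, a) := u in
  (a == 0) && (0 <= x) ||
  (0 < a) && (t (a^-1 *: rneg x) == a^-1 *: rneg x).

Definition unit_le u v : bool := unit_ge0 (v - u).

Definition unit_abs u : unitization t :=
  let: (x, a) := u in
  if a == 0 then unit_elt (rabs x) 0
  else unit_elt (rabs x - (2 * `|a|) *: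
                   t ((a^-1 *: rneg x) `|` ((- 1 / a) *: rpos x))) `|a|.

(* From join u v = (u + v + |u - v|) / 2. *)
Definition unit_join u v : unitization t :=
  2^-1 *: (u + v + unit_abs (u - v)).
Definition unit_meet u v : unitization t := - unit_join (- u) (- v).

Let P c := (0 <= c) && (t c == c).

Let P_ge0 c : P c -> 0 <= c. Proof. by case/andP. Qed.
Let P_fix c : P c -> t c = c. Proof. by case/andP => _ /eqP. Qed.

Let P0 : P 0.
Proof.
rewrite /P lexx /=; apply/eqP/le_anti.
by rewrite trunc_le // trunc_ge0.
Qed.

Let P_down x c : 0 <= x -> x <= c -> P c -> P x.
Proof.
move=> x0 xc Pc; rewrite /P x0 /=; apply/eqP/le_anti; rewrite trunc_le //=.
have := meet_trunc_le t x0 (P_ge0 Pc).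
by rewrite (P_fix Pc) (meet_idPl xc).
Qed.

Let P_join c d : P c -> P d -> P (c `|` d).
Proof.
move=> Pc Pd; have cd0 : 0 <= c `|` d by rewrite lexU2 // P_ge0.
rewrite /P cd0 /=; apply/eqP/le_anti; rewrite trunc_le //= leUx.
have := meet_trunc_le t cd0 (P_ge0 Pc); rewrite (P_fix Pc).
have := meet_trunc_le t cd0 (P_ge0 Pd); rewrite (P_fix Pd).
by rewrite (meet_idPr (leUl _ _)) (meet_idPr (leUr _ _)) => -> ->.
Qed.

Let P_trunc x : 0 <= x -> P (t x).
Proof.
move=> x0; have tx0 := trunc_ge0 t x0.
rewrite /P tx0 /=; apply/eqP/le_anti; rewrite trunc_le //=.
by have := meet_trunc_le t tx0 x0; rewrite meetxx.
Qed.

Let leZ a x y : 0 <= a -> x <= y -> a *: x <= a *: y.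
Proof.
by move=> a0 xy; rewrite -riesz_subr_ge0 -scalerBr riesz_scale_ge0 // riesz_subr_ge0.
Qed.

Let leD x y x' y' : x <= y -> x' <= y' -> x + x' <= y + y'.
Proof.
move=> xy xy'; apply: (@le_trans _ _ (y + x')); first by rewrite riesz_leD.
by rewrite ![y + _]addrC riesz_leD.
Qed.

Let ge0N x y : (0 <= x + y) = (- x <= y).
Proof. by rewrite -[RHS]riesz_subr_ge0 opprK addrC. Qed.

Let coneP x a :
  reflect (0 <= a /\ exists2 c, P c & 0 <= x + a *: c)
          (unit_ge0 (unit_elt x a)).
Proof.
apply: (iffP idP) => /= [|[a0 [c Pc xc]]].
  case/orP => /andP[].
    by move=> /eqP-> x0; split=> //; exists 0; rewrite ?scaler0 ?addr0 //; exact: P0.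
  move=> a0 /eqP h; split; first exact: ltW.
  exists (a^-1 *: rneg x).
    by rewrite /P h eqxx riesz_scale_ge0 ?rneg_ge0 // invr_ge0 ltW.
  by rewrite scalerA mulfV ?gt_eqF // scale1r -rposE rpos_ge0.
case: (eqVneq a 0) xc => [->|an]; first by rewrite scale0r addr0 => ->.
have {an}a0 : 0 < a by rewrite lt_def an.
move=> xc; rewrite a0 /=.
suff /andP[] : P (a^-1 *: rneg x) by [].
apply: (P_down _ _ Pc).
  by rewrite riesz_scale_ge0 ?rneg_ge0 // invr_ge0 ltW.
rewrite -(riesz_leZ _ _ a0) scalerA mulfV ?gt_eqF // scale1r leUx.
by rewrite -ge0N xc /= riesz_scale_ge0 ?(ltW a0) ?P_ge0.
Qed.

Let cone_widen x a c d : 0 <= a -> P c -> P d -> 0 <= x + a *: c ->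
  0 <= x + a *: (c `|` d).
Proof.
move=> a0 Pc Pd h; apply: (le_trans h).
by apply: leD => //; apply: leZ => //; exact: leUl.
Qed.

Let coneD u v : unit_ge0 u -> unit_ge0 v -> unit_ge0 (u + v).
Proof.
case: u v => [x a] [y b] /coneP[a0 [c Pc xc]] /coneP[b0 [d Pd yd]].
apply/coneP; split; first exact: addr_ge0.
exists (c `|` d); first exact: P_join.
rewrite scalerDl addrACA; apply: riesz_addr_ge0; first exact: cone_widen.
by rewrite joinC; exact: cone_widen.
Qed.

Let coneZ k u : 0 <= k -> unit_ge0 u -> unit_ge0 (k *: u).
Proof.
case: u => [x a] k0 /coneP[a0 [c Pc xc]].
apply/coneP; split; first exact: mulr_ge0.
by exists c => //; rewrite -scalerA -scalerDr riesz_scale_ge0.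
Qed.

Let cone_half u : unit_ge0 (2^-1 *: u) = unit_ge0 u.
Proof.
have i0 : 0 <= 2^-1 :> R by rewrite invr_ge0 ler0n.
apply/idP/idP; last exact: coneZ.
move=> /(coneZ (ler0n R 2)).
by rewrite scalerA mulfV ?scale1r // pnatr_eq0.
Qed.

Lemma unit_le_refl : reflexive unit_le.
Proof. by move=> u; rewrite /unit_le subrr /= eqxx lexx. Qed.

Lemma unit_le_anti : antisymmetric unit_le.
Proof.
move=> u v; rewrite /unit_le -opprB => /andP[]; set w := u - v.
suff w0 : unit_ge0 (- w) -> unit_ge0 w -> w = 0.
  by move=> h1 h2; apply/eqP; rewrite -subr_eq0; apply/eqP; exact: w0.
case: w => [x a] /coneP[na0 [c Pc xc]] /coneP[a0 [d Pd xd]].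
have a00 : a = 0 by apply: le_anti; rewrite a0 -oppr_ge0 na0.
move: xc xd; rewrite a00 oppr0 !scale0r !addr0 => xc xd.
suff -> : x = 0 by [].
by apply: le_anti; rewrite xd andbT -riesz_leN oppr0.
Qed.

Lemma unit_le_trans : transitive unit_le.
Proof.
move=> v u w uv vw; rewrite /unit_le.
have -> : w - u = (w - v) + (v - u) by rewrite addrA subrK.
exact: coneD.
Qed.

Lemma unit_absN u : unit_abs (- u) = unit_abs u.
Proof.
case: u => [x a]; rewrite /unit_abs /= oppr_eq0 rabsN.
case: eqP => // /eqP a0; rewrite normrN invrN rnegN rposN joinC.
by rewrite !mulN1r opprK.
Qed.

Let absE x a : 0 < a ->
  unit_abs (unit_elt x a) =
  unit_elt (rabs x - (2 * a) *: t (a^-1 *: rneg x)) a.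
Proof.
move=> a0; rewrite /= gt_eqF // gtr0_norm //.
congr (unit_elt (_ - _ *: t _) _); apply: join_l.
have ai : 0 <= a^-1 by rewrite invr_ge0 ltW.
apply: (@le_trans _ _ 0); last by rewrite riesz_scale_ge0 ?rneg_ge0.
by rewrite mulN1r scaleNr -oppr0 riesz_leN riesz_scale_ge0 ?rpos_ge0.
Qed.

Let wlog_pos (Q : unitization t -> Prop) :
  (forall u, Q u -> Q (- u)) ->
  (forall x, Q (unit_elt x 0)) ->
  (forall x a, 0 < a -> Q (unit_elt x a)) -> forall u, Q u.
Proof.
move=> QN Q0 Qp [x a]; case: (ltgtP a 0) => [a0|a0|->]; [|exact: Qp|exact: Q0].
rewrite -[(x, a)]opprK; apply: QN; rewrite -/(unit_elt _ _).
by apply: Qp; rewrite oppr_gt0.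
Qed.

Let trunc_scale_le a x : 0 < a -> 0 <= x -> a *: t (a^-1 *: x) <= x.
Proof.
move=> a0 x0; have h : 0 <= a^-1 *: x by rewrite riesz_scale_ge0 // invr_ge0 ltW.
have := leZ (ltW a0) (trunc_le t h).
by rewrite scalerA mulfV ?gt_eqF // scale1r.
Qed.

Let P_scale a x : 0 < a -> 0 <= x -> P (t (a^-1 *: x)).
Proof. by move=> a0 x0; rewrite P_trunc // riesz_scale_ge0 // invr_ge0 ltW. Qed.

Let leP x a y b :
  reflect (a <= b /\ exists2 c, P c & 0 <= y - x + (b - a) *: c)
          (unit_le (unit_elt x a) (unit_elt y b)).
Proof. by rewrite -subr_ge0; exact: (coneP (y - x) (b - a)). Qed.

Let unit_eltN x a : - unit_elt x a = unit_elt (- x) (- a). Proof. by []. Qed.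

Let abs0E x : unit_abs (unit_elt x 0) = unit_elt (rabs x) 0.
Proof. by rewrite /= eqxx. Qed.

Let unit_abs_ub u : unit_le u (unit_abs u) /\ unit_le (- u) (unit_abs u).
Proof.
elim/wlog_pos: u => [u [h1 h2]|x|x a a0].
- by rewrite unit_absN opprK.
- rewrite abs0E unit_eltN oppr0; split; apply/leP; rewrite lexx; split => //;
    exists 0; rewrite ?scaler0 ?addr0 ?riesz_subr_ge0 //; try exact: P0.
    exact: leUl.
  exact: leUr.
- rewrite absE // unit_eltN; set c := t _.
  have Pc : P c by apply: P_scale => //; exact: rneg_ge0.
  split; apply/leP.
    split=> //; exists 0; first exact: P0.
    rewrite scaler0 addr0 rabsE addrAC (addrAC x) subrr add0r.
    rewrite -scalerA -scaler_nat -scalerBr riesz_scale_ge0 ?ler0n //.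
    by rewrite riesz_subr_ge0 trunc_scale_le ?rneg_ge0.
  split; first by rewrite (@le_trans _ _ 0) ?oppr_le0 ?ltW.
  exists c => //.
  rewrite !opprK -mulr2n -[a *+ 2]mulr_natl addrAC subrK -rabsN addrC.
  by rewrite -[X in 0 <= X + _]opprK addrC riesz_subr_ge0 ler_rabs.
Qed.

Let unit_abs_least u w : unit_le u w -> unit_le (- u) w -> unit_le (unit_abs u) w.
Proof.
elim/wlog_pos: u => [u IH|x|x a a0].
- by rewrite opprK unit_absN => h1 h2; exact: IH.
- case: w => y b; rewrite abs0E unit_eltN oppr0.
  move=> /leP[b0 [c Pc yc]] /leP[_ [d Pd yd]].
  apply/leP; split=> //; exists (c `|` d); first exact: P_join.
  move: yc yd; rewrite subr0 => yc yd.
  have := cone_widen b0 Pc Pd yc; have := cone_widen b0 Pd Pc yd.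
  rewrite (joinC d); set e := c `|` d => {}yd {}yc.
  rewrite addrAC riesz_subr_ge0; move: yc yd.
  by rewrite addrAC riesz_subr_ge0 addrAC riesz_subr_ge0 leUx => -> ->.
- case: w => y b; rewrite absE // unit_eltN.
  move=> /leP[ab [c Pc yc]] /leP[ab' [d Pd yd]].
  apply/leP; split=> //; exists (c `|` d); first exact: P_join.
  move: ab ab'; rewrite -subr_ge0 -[(- a <= b)]subr_ge0 => b1 b2.
  have {}yc := cone_widen b1 Pc Pd yc.
  have {}yd : 0 <= y - - x + (b - - a) *: (c `|` d).
    by rewrite joinC; exact: cone_widen.
  have : P (c `|` d) by exact: P_join.
  move: (c `|` d) yc yd => e yc yd Pe {c d Pc Pd}.
  set p := rneg x; set s := t _.
  have Ps : P s by apply: P_scale => //; exact: rneg_ge0.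
  have key : p <= rpos (- x - a *: e) + a *: s.
    rewrite leUx; apply/andP; split; last first.
      apply: riesz_addr_ge0; first exact: rpos_ge0.
      by apply: riesz_scale_ge0; [exact: ltW|exact: P_ge0].
    set z := rpos _; rewrite addrC -[leLHS](subrK z) riesz_leD.
    set q := - x - z; have q1 : q <= a *: e.
      have : 0 <= z - (- x - a *: e) by rewrite riesz_subr_ge0; exact: leUl.
      by rewrite -[q <= _]riesz_subr_ge0 !opprB addrCA.
    have q2 : q <= p.
      apply: (@le_trans _ _ (- x)); last exact: leUl.
      by rewrite -riesz_subr_ge0 opprB addrCA subrr addr0 rpos_ge0.
    have ap : 0 <= a^-1 *: p.
      by rewrite riesz_scale_ge0 ?rneg_ge0 // invr_ge0 ltW.
    have aV (r : E) : r = a *: (a^-1 *: r) by rewrite scalerA mulfV ?scale1r // gt_eqF.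
    rewrite (aV q) riesz_leZ //; apply: (le_trans _ (meet_trunc_le t ap (P_ge0 Pe))).
    rewrite (P_fix Pe) lexI -[X in X && _](riesz_leZ _ _ a0).
    by rewrite -[X in _ && X](riesz_leZ _ _ a0) -!aV q1 q2.
  set z := rpos _ in key; set G := y + (b - a) *: e.
  have h1 : x <= G by rewrite -riesz_subr_ge0 addrAC.
  have h2 : - x - (2 * a) *: e <= G.
    rewrite -riesz_subr_ge0.
    suff -> : G - (- x - (2 * a) *: e) = y - - x + (b - - a) *: e by [].
    rewrite /G opprB !opprK addrA -[y + (b - a) *: e + _]addrA -scalerDl addrAC.
    by congr (_ + _ *: _); rewrite mulr_natl mulr2n addrA subrK.
  have h : z *+ 2 + x <= G.
    rewrite -scaler_nat riesz_joinZ ?ltr0n // scaler0 riesz_joinD leUx add0r h1 andbT.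
    suff -> : 2 *: (- x - a *: e) + x = - x - (2 * a) *: e by [].
    by rewrite scalerBr scalerA scalerN addrAC scaler_nat mulr2n opprD subrK.
  rewrite addrAC riesz_subr_ge0; apply: le_trans h.
  rewrite rabsE -addrA addrC riesz_leD -scalerA -!scaler_nat -scalerBr.
  by rewrite riesz_leZ ?ltr0n // -(riesz_leD (a *: s)) subrK.
Qed.

Lemma unit_abs_le u w :
  unit_le (unit_abs u) w = unit_le u w && unit_le (- u) w.
Proof.
have [h1 h2] := unit_abs_ub u.
apply/idP/andP => [h|[]]; last exact: unit_abs_least.
by split; [exact: unit_le_trans h1 h|exact: unit_le_trans h2 h].
Qed.

Let unit_le_half u v : unit_le (2^-1 *: u) v = unit_le u (v *+ 2).
Proof.
rewrite /unit_le -[RHS]cone_half scalerBr -[v *+ 2]scaler_nat.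
by rewrite scalerA mulVf ?scale1r // pnatr_eq0.
Qed.

Let unit_leD w u v : unit_le (u + w) (v + w) = unit_le u v.
Proof. by rewrite /unit_le opprD addrACA subrr addr0. Qed.

Lemma unit_leUx u v w : unit_le (unit_join u v) w = unit_le u w && unit_le v w.
Proof.
have le2 z : unit_le z w = unit_le (z *+ 2) (w *+ 2).
  rewrite -unit_le_half -[z *+ 2]scaler_nat.
  by rewrite scalerA mulVf ?scale1r // pnatr_eq0.
rewrite unit_le_half (le2 u) (le2 v) -(unit_leD (- (u + v))) addrC addKr.
rewrite unit_abs_le -(unit_leD (u + v)) subrK; congr (_ && _).
  by rewrite addrACA addNr addr0 mulr2n.
by rewrite -(unit_leD (u + v)) subrK opprB [u + v]addrC addrACA addNr addr0 mulr2n.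
Qed.

Lemma unit_lexI u v w : unit_le u (unit_meet v w) = unit_le u v && unit_le u w.
Proof.
have leN u1 u2 : unit_le u1 u2 = unit_le (- u2) (- u1) by rewrite /unit_le opprK addrC.
by rewrite leN opprK unit_leUx -!leN.
Qed.

Lemma unit_leD2r w u v : unit_le u v -> unit_le (u + w) (v + w).
Proof. by rewrite unit_leD. Qed.

Lemma unit_scale_ge0 (k : R) u : 0 <= k -> unit_le 0 u -> unit_le 0 (k *: u).
Proof. by rewrite /unit_le !subr0; exact: coneZ. Qed.

Lemma unit_le_trunc x w : 0 <= x ->
  unit_le w (unit_elt (t x) 0) =
  unit_le w (unit_elt 0 1) && unit_le w (unit_elt x 0).
Proof.
move=> x0; have Pt : P (t x) by exact: P_trunc.
apply/idP/andP => [h|[]].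
  split; apply: (unit_le_trans h); apply/leP.
    split; first exact: ler01.
    by exists (t x) => //; rewrite sub0r subr0 scale1r addNr.
  split=> //; exists 0; first exact: P0.
  by rewrite scaler0 addr0 riesz_subr_ge0 trunc_le.
case: w => y b /leP[b1 [c Pc yc]] /leP[b0 [d Pd yd]].
apply/leP; split=> //; exists (c `|` d); first exact: P_join.
have b1' : 0 <= 1 - b by rewrite subr_ge0.
have b0' : 0 <= 0 - b by rewrite subr_ge0.
have {}yc := cone_widen b1' Pc Pd yc.
have {}yd : 0 <= x - y + (0 - b) *: (c `|` d).
  by rewrite joinC; exact: cone_widen.
have : P (c `|` d) by exact: P_join.
move: (c `|` d) yc yd => e yc yd Pe.
set z := y + b *: e.
have h1 : z <= e.
  rewrite -riesz_subr_ge0; move: yc.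
  by rewrite scalerBl scale1r sub0r addrCA -opprD.
have h2 : z <= x.
  rewrite -riesz_subr_ge0; move: yd.
  by rewrite sub0r scaleNr -addrA -opprD.
rewrite sub0r scaleNr -addrA -opprD riesz_subr_ge0.
apply: le_trans (meet_trunc_le t x0 (P_ge0 Pe)).
by rewrite (P_fix Pe) lexI h1 h2.
Qed.

End UnitizationOrder.

HB.instance Definition _ (R : realType) (E : rieszType R) (t : truncation E) :=
  Order.Le_isPOrder.Build ring_display (unitization t)
    (@unit_le_refl R E t) (@unit_le_anti R E t) (@unit_le_trans R E t).

HB.instance Definition _ (R : realType) (E : rieszType R) (t : truncation E) :=
  POrderedLmodule_isRiesz.Build R (unitization t)
    (@unit_lexI R E t) (@unit_leUx R E t) (@unit_leD2r R E t)
    (@unit_scale_ge0 R E t).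

HB.instance Definition _ (R : realType) (E : rieszType R) (t : truncation E) :=
  Order.POrder_MeetJoin_isLattice.Build ring_display (unitization t)
    (@unit_lexI R E t) (@unit_leUx R E t).

Section UnitizationTheory.
Context {R : realType} {E : rieszType R} (t : truncation E).
Implicit Types (x y : E) (a : R) (u v : unitization t).

Lemma unit_subr_ge0 u v : (u <= v) = unit_ge0 (v - u).
Proof. by []. Qed.

Lemma rabs_unitE u : rabs u = unit_abs u.
Proof.
apply: le_anti; apply/andP; split.
  move: (unit_le_refl (unit_abs u)); rewrite unit_abs_le => /andP[h1 h2].
  by rewrite leUx; apply/andP; split.
suff : unit_le (unit_abs u) (rabs u) by [].
rewrite unit_abs_le; apply/andP; split; first exact: (ler_rabs u).
by have := ler_rabs (- u); rewrite rabsN.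
Qed.

Lemma le_unit_elt0 x y : (unit_elt t x 0 <= unit_elt t y 0) = (x <= y).
Proof.
rewrite unit_subr_ge0 /= subrr eqxx ltxx /= orbF.
exact: (riesz_subr_ge0 x y).
Qed.

Lemma rabs_unit_elt0 x : rabs (unit_elt t x 0) = unit_elt t (rabs x) 0.
Proof. by rewrite rabs_unitE /= eqxx. Qed.

Lemma join_unit_elt0 x y :
  unit_elt t x 0 `|` unit_elt t y 0 = unit_elt t (x `|` y) 0.
Proof.
suff h z w : z `|` w = 2^-1 *: (z + w + rabs (z - w)) :> E.
  have -> : unit_elt t x 0 `|` unit_elt t y 0 =
      unit_join (unit_elt t x 0) (unit_elt t y 0) by [].
  rewrite /unit_join -rabs_unitE.
  have -> : unit_elt t x 0 - unit_elt t y 0 = unit_elt t (x - y) 0.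
    by congr (_, _); exact: subrr.
  rewrite rabs_unit_elt0 h; congr (_, _).
  by rewrite /= !addr0; exact: mulr0.
have -> : rabs (z - w) = (z *+ 2 `|` w *+ 2) - (z + w).
  rewrite riesz_joinD /rabs !mulr2n opprB !opprD.
  rewrite addrACA subrr add0r [- z - w]addrC addrACA subrr add0r.
  by [].
rewrite addrC subrK -!scaler_nat -riesz_joinZ ?ltr0n // scalerA mulVf ?scale1r //.
by rewrite pnatr_eq0.
Qed.

Lemma meet_unit_elt0 x y :
  unit_elt t x 0 `&` unit_elt t y 0 = unit_elt t (x `&` y) 0.
Proof.
have EN z : - unit_elt t z 0 = unit_elt t (- z) 0.
  by congr (_, _); exact: oppr0.
have -> : unit_elt t x 0 `&` unit_elt t y 0 =
    - (- unit_elt t x 0 `|` - unit_elt t y 0) by [].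
rewrite !EN join_unit_elt0 EN; congr (_, _); apply: le_anti.
apply/andP; split; last first.
  by rewrite -riesz_leN opprK leUx !riesz_leN leIl leIr.
by rewrite lexI -[X in X && _]riesz_leN -[X in _ && X]riesz_leN opprK leUl leUr.
Qed.

Lemma truncE x : 0 <= x ->
  unit_elt t (t x) 0 = unit_elt t 0 1 `&` unit_elt t x 0.
Proof.
move=> x0; have H := fun w : unitization t => unit_le_trunc w x0.
apply: le_anti; apply/andP; split; last first.
  suff : unit_le (unit_elt t 0 1 `&` unit_elt t x 0) (unit_elt t (t x) 0) by [].
  have h1 : unit_elt t 0 1 `&` unit_elt t x 0 <= unit_elt t 0 1 by exact: leIl.
  have h2 : unit_elt t 0 1 `&` unit_elt t x 0 <= unit_elt t x 0 by exact: leIr.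
  by rewrite H; apply/andP; split.
move: (unit_le_refl (unit_elt t (t x) 0)); rewrite H => /andP[h1 h2].
by rewrite lexI; apply/andP; split.
Qed.

Lemma rabs_sub_in_E x a :
  exists y, rabs (unit_elt t x a) - unit_elt t 0 `|a| = unit_elt t y 0.
Proof.
rewrite rabs_unitE /=; case: eqP => [->|_].
  exists (rabs x); rewrite normr0.
  by congr (_, _); rewrite /= subr0.
eexists; congr (_, _); exact: subrr.
Qed.

Lemma rpos_unit_elt0 x : rpos (unit_elt t x 0) = unit_elt t (rpos x) 0.
Proof. exact: join_unit_elt0. Qed.

End UnitizationTheory.

Section UnitizationNorm.
Context {R : realType} {E : rieszType R} (t : truncation E).
Implicit Types (x : E) (a : R).

Record unitization_norm (N : E -> R) (Nu : unitization t -> R) : Prop :=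
  UnitizationNorm {
    un_lattice_norm : lattice_norm Nu ;
    un_extends : forall x, Nu (unit_elt t x 0) = N x ;
    un_one : Nu (unit_elt t 0 1) = 1
  }.

(* By [rabs_sub_in_E] and [rpos_unit_elt0], (|x + a| - |a|)^+ lies in E, so
   that its first component is that very element. *)
Definition norm1 (N : E -> R) (u : unitization t) : R :=
  let: (x, a) := u in
  N (rpos (rabs (unit_elt t x a) - unit_elt t 0 `|a|)).1 + `|a|.

End UnitizationNorm.

(* Main.v *)
Require Import Defs.
From mathcomp Require Import all_boot all_order all_algebra.
From mathcomp Require Import boolp classical_sets reals.

Import Order.TTheory GRing.Theory Num.Theory.

Local Open Scope ring_scope.

(** For u = x + a, put f(u) = (|u| - |a|)^+, an element of E^+, so that
    norm1 u = N (f u) + |a| and |u| <= f(u) + |a|.  The point is that this is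
    the cheapest majorant of |u| of that shape:

      norm1 u = min {N y + r : y in E^+, |u| <= y + r}.

    To see that any such majorant costs at least norm1 u, let s = r - |a|.
    Comparing scalar parts gives s >= 0, and f(u) <= y + p, where
    p = (f(u) - y)^+ is at most s.  If s = 0 then p = 0; otherwise s^-1 p is
    a fixed point of the truncation, and the normalization of N bounds the norm of such a point by 1.
    Either way N p <= s, whence N (f u) + |a| <= N y + r ([norm1_le_majorant]).

    Everything follows from this minimality.  If |u| <= |v| with v = y + b, then
    f(v) + |b| also majorizes |u|; the sum of the majorants of u and v majorizes |u + v|;
    and |k| times the majorant of u majorizes |k u|.  This makes norm1 a
    lattice norm.  If Nu is any unitization norm, then
    Nu u <= Nu (f(u) + |a|) <= N (f u) + |a|, so norm1 is the largest one. *)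

Section RieszAbs.
Set Implicit Arguments.
Unset Strict Implicit.
Context {R : realType} {E : rieszType R}.
Implicit Types (x y : E) (k : R).

Lemma riesz_leD2 x y x' y' : x <= y -> x' <= y' -> x + x' <= y + y'.
Proof.
move=> xy xy'; apply: (@le_trans _ _ (y + x')); first by rewrite riesz_leD.
by rewrite ![y + _]addrC riesz_leD.
Qed.

Lemma rabs_ge0 x : 0 <= rabs x.
Proof.
rewrite rabsE mulr2n addrA -rposE.
by apply: riesz_addr_ge0; [exact: rpos_ge0 | exact: rneg_ge0].
Qed.

Lemma rpos_rabs x : rpos (rabs x) = rabs x.
Proof. exact: join_l (rabs_ge0 x). Qed.

Lemma ger0_rabs x : 0 <= x -> rabs x = x.
Proof.
move=> x0; apply: join_l; apply: (@le_trans _ _ 0) => //.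
by rewrite -oppr0 riesz_leN.
Qed.

Lemma ler_rabsD x y : rabs (x + y) <= rabs x + rabs y.
Proof.
rewrite {1}/rabs leUx opprD; apply/andP; split; apply: riesz_leD2;
  by [exact: leUl | exact: leUr].
Qed.

Lemma ler_scale_rabs k x : k *: x <= `|k| *: rabs x.
Proof.
rewrite -riesz_subr_ge0; case: (ger0P k) => k0.
  by rewrite -scalerBr riesz_scale_ge0 // riesz_subr_ge0 ler_rabs.
rewrite -[k *: x]opprK -scalerN -scaleNr -scalerBr.
by rewrite riesz_scale_ge0 ?oppr_ge0 ?(ltW k0) // riesz_subr_ge0 leUr.
Qed.

Lemma ler_rabsZ k x : rabs (k *: x) <= `|k| *: rabs x.
Proof.
rewrite {1}/rabs leUx ler_scale_rabs /=.
by rewrite -scaleNr -(normrN k) ler_scale_rabs.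
Qed.

Lemma lnorm_rabs (N : E -> R) (hN : lattice_norm N) x : N (rabs x) = N x.
Proof.
have idem := ger0_rabs (rabs_ge0 x).
by apply: le_anti; rewrite !(lnorm_mono hN) // idem.
Qed.

Lemma ler_lnorm (N : E -> R) (hN : lattice_norm N) x y :
  0 <= x -> x <= y -> N x <= N y.
Proof.
move=> x0 xy; apply: (lnorm_mono hN).
by rewrite !ger0_rabs // (le_trans x0 xy).
Qed.

End RieszAbs.

Section LargestNorm.
Set Implicit Arguments.
Unset Strict Implicit.
Context {R : realType} {E : rieszType R} (t : truncation E) (N : E -> R).
Implicit Types (x y : E) (a r : R) (u v w : unitization t).

Lemma rabs_unit_snd u : (rabs u).2 = `|u.2|.
Proof.
by rewrite rabs_unitE; case: u => x a /=; case: eqP => // ->; rewrite normr0.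
Qed.

(** The E-component of |u| is |u| - |a|, so its positive part is the element
    of E whose norm enters [norm1]. *)
Lemma norm1E u : norm1 N u = N (rpos (rabs u).1) + `|u.2|.
Proof.
case: u => x a; rewrite /norm1 -/(unit_elt t x a).
suff -> : rabs (unit_elt t x a) - unit_elt t 0 `|a| =
          unit_elt t (rabs (unit_elt t x a)).1 0.
  by rewrite rpos_unit_elt0.
have := rabs_unit_snd (unit_elt t x a).
case: (rabs _) => m b /= ->.
by congr (_, _); [exact: subr0 | exact: subrr].
Qed.

(** Attainment of the minimum: f(u) + |a| is itself a majorant of |u|. *)
Lemma rabs_le_majorant u : rabs u <= unit_elt t (rpos (rabs u).1) `|u.2|.
Proof.
have := rabs_unit_snd u; case: (rabs u) => m b /= <-.
rewrite unit_subr_ge0 /= subrr eqxx /= riesz_subr_ge0.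
by rewrite leUl.
Qed.

Hypothesis hN : truncated_norm t N.
Let lN : lattice_norm N := trn_lattice_norm hN.

Lemma trunc_norm_le1 x : 0 <= x -> N (t x) <= 1.
Proof.
move=> x0; rewrite -(trn_sup hN); apply: sup_upper_bound; last by exists x.
split; first by exists (N (t x)), x.
exact: trn_bounded hN.
Qed.

Lemma trunc_fixed_norm_le a x :
  0 < a -> 0 <= x -> t (a^-1 *: x) = a^-1 *: x -> N x <= a.
Proof.
move=> a0 x0 tx.
have -> : x = a *: t (a^-1 *: x) by rewrite tx scalerA mulfV ?scale1r ?gt_eqF.
rewrite (lnormZ lN) gtr0_norm // -[leRHS]mulr1 ler_pM2l // trunc_norm_le1 //.
by rewrite riesz_scale_ge0 // invr_ge0 ltW.
Qed.

(** Minimality, by unfolding the cone that defines the order of the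
    unitization: either the scalar parts agree, and y >= f(w) in E, or
    the failure of y >= f(w) is a multiple of a fixed point of the
    truncation. *)
Lemma norm1_le_majorant w y r :
  0 <= y -> rabs w <= unit_elt t y r -> norm1 N w <= N y + r.
Proof.
move=> y0; rewrite norm1E -rabs_unit_snd.
case: (rabs w) => m b /=; rewrite unit_subr_ge0 /=.
case/orP => /andP[].
  rewrite subr_eq0 => /eqP->; rewrite riesz_subr_ge0 => my.
  by rewrite lerD2r (ler_lnorm lN) ?rpos_ge0 // leUx my.
move=> s0 /eqP tp; set p := rneg (y - m) in tp.
have p0 : 0 <= p by exact: rneg_ge0.
have mp : rpos m <= y + p.
  rewrite leUx riesz_addr_ge0 // andbT -(riesz_leD (- y)) [y + p]addrC addrK.
  by rewrite -opprB; exact: leUl.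
have Np : N p <= r - b by exact: trunc_fixed_norm_le tp.
rewrite -lerBrDr -addrA.
apply: le_trans (ler_lnorm lN (rpos_ge0 m) mp) _.
by apply: le_trans (ler_lnormD lN _ _) _; rewrite lerD2l.
Qed.

Lemma norm1_lattice_norm : lattice_norm (norm1 N : unitization t -> R).
Proof.
have ge0 u : 0 <= norm1 N u by rewrite norm1E addr_ge0 // (lnorm_ge0 lN).
have scale k u : norm1 N (k *: u) <= `|k| * norm1 N u.
  rewrite [in leRHS]norm1E mulrDr -{1}(normr_id k) -(lnormZ lN).
  apply: norm1_le_majorant.
    by rewrite riesz_scale_ge0 // rpos_ge0.
  apply: (le_trans (ler_rabsZ k u)); rewrite -riesz_subr_ge0.
  have -> : unit_elt t (`|k| *: rpos (rabs u).1) (`|k| * `|u.2|) =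
            `|k| *: unit_elt t (rpos (rabs u).1) `|u.2| by [].
  rewrite -scalerBr riesz_scale_ge0 // riesz_subr_ge0.
  exact: rabs_le_majorant.
split=> //.
- case=> x a; rewrite norm1E => /eqP.
  rewrite paddr_eq0 ?(lnorm_ge0 lN) // normr_eq0 => /andP[/eqP Nx /eqP /= a0].
  move: Nx; rewrite a0 -/(unit_elt t x 0) rabs_unit_elt0 /=.
  rewrite rpos_rabs (lnorm_rabs lN) => /(lnorm0_eq0 lN) ->.
  by [].
- move=> k u.
  (* The reverse inequality is the same estimate for k^-1 and k *: u. *)
  apply: le_anti; rewrite scale andTb.
  have [->|k0] := eqVneq k 0; first by rewrite normr0 mul0r ge0.
  rewrite mulrC -ler_pdivlMr ?normr_gt0 // mulrC -normfV.
  by apply: le_trans (scale k^-1 (k *: u)); rewrite scalerA mulVf // scale1r.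
- move=> u v; rewrite [norm1 N u]norm1E [norm1 N v]norm1E addrACA.
  have h : rabs (u + v) <=
      unit_elt t (rpos (rabs u).1 + rpos (rabs v).1) (`|u.2| + `|v.2|).
    apply: le_trans (ler_rabsD u v) _.
    exact: riesz_leD2 (rabs_le_majorant u) (rabs_le_majorant v).
  apply: le_trans (norm1_le_majorant _ h) _.
    by rewrite riesz_addr_ge0 // rpos_ge0.
  by rewrite lerD2r (ler_lnormD lN).
- move=> u v uv; rewrite [leRHS]norm1E; apply: norm1_le_majorant.
    exact: rpos_ge0.
  exact: le_trans uv (rabs_le_majorant v).
Qed.

Lemma norm1_unitization_norm : unitization_norm (t := t) N (norm1 N).
Proof.
split; first exact: norm1_lattice_norm.
  move=> x; rewrite norm1E rabs_unit_elt0 /= normr0 addr0.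
  by rewrite rpos_rabs (lnorm_rabs lN).
have N0 : N 0 = 0 by rewrite -(scale0r (0 : E)) (lnormZ lN) normr0 mul0r.
apply: le_anti; apply/andP; split.
  rewrite -[leRHS]add0r -N0; apply: norm1_le_majorant => //.
  rewrite ger0_rabs // unit_subr_ge0.
  have -> : unit_elt t 0 1 - 0 = unit_elt t 0 1 by exact: subr0.
  apply/orP; right; apply/andP; split; first exact: ltr01.
  have r0 : rneg (0 : E) = 0 by rewrite /rneg oppr0 joinxx.
  rewrite r0 scaler0; apply/eqP/le_anti.
  by rewrite trunc_le // trunc_ge0.
by rewrite norm1E /= normr1 lerDr (lnorm_ge0 lN).
Qed.

Lemma unitization_norm_le_norm1 (Nu : unitization t -> R) u :
  unitization_norm N Nu -> Nu u <= norm1 N u.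
Proof.
case=> lNu ext one; rewrite norm1E -(lnorm_rabs lNu).
apply: le_trans (ler_lnorm lNu (rabs_ge0 u) (rabs_le_majorant u)) _.
have -> : unit_elt t (rpos (rabs u).1) `|u.2| =
    unit_elt t (rpos (rabs u).1) 0 + `|u.2| *: unit_elt t 0 1.
  congr (_, _) => /=; first by rewrite scaler0 addr0.
  by rewrite add0r; exact/esym/mulr1.
apply: le_trans (ler_lnormD lNu _ _) _.
by rewrite (lnormZ lNu) ext one mulr1 normr_id.
Qed.

End LargestNorm.

Theorem theorem2p1 (R : realType) (E : rieszType R) (t : truncation E)
    (N : E -> R) (hN : truncated_norm t N) :
  unitization_norm (t := t) N (norm1 N) /\
  (forall Nu : unitization t -> R, unitization_norm N Nu ->
     forall (x : E) (a : R),
       Nu (unit_elt t x a) <= norm1 N (unit_elt t x a)).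
Proof.
split; first exact: norm1_unitization_norm.
by move=> Nu hNu x a; exact: unitization_norm_le_norm1.
Qed.
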